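(* Let $H$ be a finitely generated subgroup of the free group $F_2=F(\{a,b\})$. If the folding $\Gamma_H=(V,E)$ of $H$ has a directed trail decomposition, then $\Gamma_H$ is $3$-balanced.
   Context: For a finitely generated subgroup $H$ of a free group $F(X)$, the folding $\Gamma_H=(V_H,E_H)$ is the (Stallings) directed multigraph, loops allowed, with a distinguished vertex $1_H$ and with each directed edge labeled by an element of $X$, obtained as follows: take a finite set of freely reduced words generating $H$, form the rose consisting of one closed path at $1_H$ for each generator, labeled by the successive letters of that generator (a letter $x^{-1}$ corresponds to traversing an edge labeled $x$ backwards), and repeatedly identify pairs of edges that have the same label and the same head, or the same label and the same tail, until no such pair remains. Up to isomorphism the result depends only on $H$; it is a finite connected graph in which distinct edges with the same label have distinct heads and distinct tails, and the set of freely reduced elements of $H$ is the set of words read along closed non-backtracking walks starting and ending at $1_H$ (edges may be traversed in either direction). When $X=\{a,b\}$, every vertex has at most two incoming edges (at most one labeled $a$ and at most one labeled $b$) and at most two outgoing edges (likewise). The degree of a vertex is the sum of its in-degree and out-degree. Vertices of degree $3$ in $\Gamma_H$ (for $X=\{a,b\}$) fall into four types according to the labels and directions of their incident edges: types $C_1$ and $C_3$ are the two types with two outgoing edges and one incoming edge (distinguished by the label of the incoming edge), and types $C_2$ and $C_4$ are the two types with two incoming edges and one outgoing edge (distinguished by the label of the outgoing edge). Let $C_i(\Gamma)$ be the number of degree $3$ vertices of type $C_i$ in $\Gamma$. The folding $\Gamma$ is $3$-balanced if $C_1(\Gamma)+C_3(\Gamma)=C_2(\Gamma)+C_4(\Gamma)$.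 A directed trail $P$ in a directed graph $\Gamma=(V,E)$ is a non-empty finite sequence of distinct directed edges $e_1,\dots,e_m$ with $\mathrm{tail}(e_{i+1})=\mathrm{head}(e_i)$ for $i=1,\dots,m-1$. Its start is $s(P)=\mathrm{tail}(e_1)$ and its terminus is $t(P)=\mathrm{head}(e_m)$. $V[P]$ denotes the set of vertices that are the head or tail of an edge of $P$. A directed trail decomposition of $\Gamma=(V,E)$ is a finite sequence of directed trails $(P_0,\dots,P_n)$ such that: (1) the edge sets of $P_0,\dots,P_n$ are pairwise disjoint and their union is $E$; (2) $s(P_0)=t(P_0)$; (3) for each $i=1,\dots,n$: if $V[P_i]\cap\bigcup_{j=0}^{i-1}V[P_j]\neq\emptyset$, then $V[P_i]\cap\bigcup_{j=0}^{i-1}V[P_j]=\{s(P_i),t(P_i)\}$; and if $V[P_i]\cap\bigcup_{j=0}^{i-1}V[P_j]=\emptyset$, then $s(P_i)=t(P_i)$. *)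

(* Defs.v *)
From HB Require Import structures.
From mathcomp Require Import all_boot.

Set Implicit Arguments.
Unset Strict Implicit.
Unset Printing Implicit Defensive.

(** * Free groups *)

(** [(x, true)] is the letter x and [(x, false)] is the letter x^-1. *)
Definition letter (X : Type) : Type := (X * bool)%type.

Definition linv (X : Type) (l : letter X) : letter X := (l.1, ~~ l.2).

Definition reduced (X : eqType) (w : seq (letter X)) : bool :=
  sorted (fun l m => m != linv l) w.

(** Left multiplication of a reduced word by a letter, with cancellation. *)
Definition lmul (X : eqType) (l : letter X) (w : seq (letter X)) :=
  if w is m :: w' then if m == linv l then w' else l :: w else [:: l].

Record freegroup (X : choiceType) := FreeGroup {
  fgword :> seq (letter X);
  fgwordP : reduced fgword
}.

HB.instance Definition _ (X : choiceType) := [isSub for @fgword X].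
HB.instance Definition _ (X : choiceType) := [Choice of freegroup X by <:].

Section FreeGroup.
Variable X : choiceType.
Implicit Types (l m : letter X) (u v w : seq (letter X)) (g h : freegroup X).

Lemma linvK : involutive (@linv X).
Proof. by case=> x b; rewrite /linv /= negbK. Qed.

Lemma linv_neq l : linv l != l.
Proof. by case: l => x [] /=; rewrite xpair_eqE andbF. Qed.

Lemma lmul_reduced l w : reduced w -> reduced (lmul l w).
Proof.
case: w => [|m w] //= redw; case: eqP => [_|/eqP ne]; first exact: path_sorted redw.
by rewrite /reduced /= ne.
Qed.

Lemma lmul_path l w : path (fun l m => m != linv l) l w -> lmul l w = l :: w.
Proof. by case: w => [|m w] //= /andP[/negPf-> _]. Qed.

Lemma lmulK l w : reduced w -> lmul (linv l) (lmul l w) = w.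
Proof.
case: w => [|m w] /= redw; first by rewrite linvK eqxx.
case: eqP redw => [-> redw|_ _]; last by rewrite /= linvK eqxx.
exact: lmul_path.
Qed.

Definition wmul u v := foldr (@lmul X) v u.

Definition winv u := rev (map (@linv X) u).

Lemma wmul_reduced u v : reduced v -> reduced (wmul u v).
Proof. by move=> redv; elim: u => //= l u; apply: lmul_reduced. Qed.

Lemma wmul_lmul l u v : reduced v -> wmul (lmul l u) v = lmul l (wmul u v).
Proof.
move=> redv; case: u => [|m u] //=; case: eqP => [->|//].
by have := @lmulK (linv l) _ (wmul_reduced u redv); rewrite linvK.
Qed.

Lemma wmulA u v w : reduced w -> wmul u (wmul v w) = wmul (wmul u v) w.
Proof. by move=> redw; elim: u => //= l u ->; rewrite wmul_lmul. Qed.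

Lemma wmul0 u : reduced u -> wmul u [::] = u.
Proof.
elim: u => //= l u IHu redu; rewrite IHu ?lmul_path //.
exact: path_sorted redu.
Qed.

Lemma winv_reduced u : reduced u -> reduced (winv u).
Proof.
rewrite /reduced /winv rev_sorted sorted_map => redu.
rewrite (@eq_sorted _ _ (fun l m => m != linv l)) // => l m /=.
by rewrite linvK eq_sym.
Qed.

Lemma winvK : involutive winv.
Proof. by move=> u; rewrite /winv map_rev revK mapK //; apply: linvK. Qed.

Lemma wmul_cat u v w : wmul (u ++ v) w = wmul u (wmul v w).
Proof. by rewrite /wmul foldr_cat. Qed.

Lemma wmulVw u w : reduced w -> wmul (winv u) (wmul u w) = w.
Proof.
move=> redw; elim: u => //= l u IHu.
rewrite /winv /= rev_cons -cats1 wmul_cat /= lmulK //.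
exact: wmul_reduced.
Qed.

Definition fgmul g h := FreeGroup (wmul_reduced g (fgwordP h)).
Definition fgone := @FreeGroup X [::] isT.
Definition fginv g := FreeGroup (winv_reduced (fgwordP g)).

Lemma fgmulA : associative fgmul.
Proof. by move=> g h k; apply: val_inj; apply: wmulA; apply: fgwordP. Qed.

Lemma fgmul1 : left_id fgone fgmul.
Proof. by move=> g; apply: val_inj. Qed.

Lemma fg1mul : right_id fgone fgmul.
Proof. by move=> g; apply: val_inj; apply: wmul0; apply: fgwordP. Qed.

Lemma fgmulV : left_inverse fgone fginv fgmul.
Proof.
move=> g; apply: val_inj => /=.
by rewrite -[X in wmul _ X](wmul0 (fgwordP g)) wmulVw.
Qed.

Lemma fgVmul : right_inverse fgone fginv fgmul.
Proof.
by move=> g; rewrite -[RHS](fgmulV (fginv g)); congr fgmul;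
  apply: val_inj; rewrite /= winvK.
Qed.

End FreeGroup.

HB.instance Definition _ (X : choiceType) := isGroup.Build (freegroup X)
  (@fgmulA X) (@fgmul1 X) (@fg1mul X) (@fgmulV X) (@fgVmul X).

Variant gen2 := gen_a | gen_b.

Definition bool_of_gen2 (x : gen2) : bool := if x is gen_a then true else false.
Definition gen2_of_bool (b : bool) : gen2 := if b then gen_a else gen_b.

Lemma bool_of_gen2K : cancel bool_of_gen2 gen2_of_bool.
Proof. by case. Qed.

HB.instance Definition _ := Finite.copy gen2 (can_type bool_of_gen2K).

(** * Finitely generated subgroups *)

Section Subgroups.
Local Open Scope group_scope.
Variable G : groupType.

Definition subgroup (H : G -> Prop) : Prop :=
  [/\ H 1, forall g h, H g -> H h -> H (g * h) & forall g, H g -> H g^-1].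

Definition generated (S : seq G) (g : G) : Prop :=
  forall K : G -> Prop, subgroup K -> (forall s, s \in S -> K s) -> K g.

Definition generates (S : seq G) (H : G -> Prop) : Prop :=
  forall g, H g <-> generated S g.

Definition finitely_generated (H : G -> Prop) : Prop :=
  exists S : seq G, generates S H.

End Subgroups.

(** * Labeled directed multigraphs and foldings *)

Record lgraph (X : Type) := LGraph {
  vert : finType;
  edge : finType;
  etail : edge -> vert;
  ehead : edge -> vert;
  elabel : edge -> X;
  base : vert
}.

Arguments etail {X l}.
Arguments ehead {X l}.
Arguments elabel {X l}.
Arguments base {X}.

Section Rose.
Variables (X : choiceType) (S : seq (freegroup X)).

Definition rose_word (i : 'I_(size S)) : seq (letter X) := tnth (in_tuple S) i.

(** A petal of length n has n edges and n.-1 vertices other than the base. *)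
Definition rose_inner : finType :=
  {i : 'I_(size S) & 'I_(size (rose_word i)).-1}.

Definition rose_vert : finType := option rose_inner.

Definition rose_edge : finType :=
  {i : 'I_(size S) & 'I_(size (rose_word i))}.

(** Vertex reached after reading the first p letters of the i-th word: the base
    for p = 0 and, as [insub] then fails, also for p = size (rose_word i). *)
Definition rose_pos (i : 'I_(size S)) (p : nat) : rose_vert :=
  if p is q.+1 then
    omap (Tagged (fun i => 'I_(size (rose_word i)).-1))
      (insub q : option 'I_(size (rose_word i)).-1)
  else None.

Definition rose_letter (e : rose_edge) : letter X :=
  tnth (in_tuple (rose_word (tag e))) (tagged e).

Definition rose_tail (e : rose_edge) : rose_vert :=
  rose_pos (tag e) (if (rose_letter e).2 then tagged e : nat else (tagged e).+1).

Definition rose_head (e : rose_edge) : rose_vert :=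
  rose_pos (tag e) (if (rose_letter e).2 then (tagged e).+1 else tagged e : nat).

Definition rose : lgraph X :=
  @LGraph X rose_vert rose_edge rose_tail rose_head
    (fun e => (rose_letter e).1) None.

End Rose.

Section Folding.
Variable X : choiceType.
Implicit Types G : lgraph X.

Definition foldable G (e1 e2 : edge G) : Prop :=
  [/\ e1 <> e2, elabel e1 = elabel e2 & ehead e1 = ehead e2 \/ etail e1 = etail e2].

Definition same_pair (T : Type) (x y p q : T) : Prop :=
  (x = p /\ y = q) \/ (x = q /\ y = p).

(** G' is (a copy of) the quotient of G by the identification of e1 with e2,
    and hence of their tails and of their heads. When e1 and e2 are foldable,
    one of the last two identifications is trivial. *)
Definition edge_identification G (e1 e2 : edge G) (G' : lgraph X) : Prop :=
  exists (fV : vert G -> vert G') (fE : edge G -> edge G'),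
  [/\ (forall v', exists v, fV v = v') /\ (forall e', exists e, fE e = e'),
      forall e, [/\ etail (fE e) = fV (etail e), ehead (fE e) = fV (ehead e)
                  & elabel (fE e) = elabel e],
      base G' = fV (base G),
      forall e f, fE e = fE f <-> e = f \/ same_pair e f e1 e2
    & forall u v, fV u = fV v <->
        [\/ u = v, same_pair u v (etail e1) (etail e2)
          | same_pair u v (ehead e1) (ehead e2)]].

Inductive folds_to : lgraph X -> lgraph X -> Prop :=
| folds_refl G : folds_to G G
| folds_step G G' G'' (e1 e2 : edge G) :
    foldable e1 e2 -> edge_identification e1 e2 G' -> folds_to G' G'' ->
    folds_to G G''.

Definition folded G : Prop := forall e1 e2 : edge G, ~ foldable e1 e2.

Definition is_folding (H : freegroup X -> Prop) (G : lgraph X) : Prop :=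
  exists S : seq (freegroup X),
    [/\ uniq S, generates S H, folds_to (rose S) G & folded G].

End Folding.

(** * 3-balanced graphs *)

Section Balanced.
Variable G : lgraph gen2.
Implicit Type v : vert G.

Definition indeg v : nat := #|[set e : edge G | ehead e == v]|.
Definition outdeg v : nat := #|[set e : edge G | etail e == v]|.

Definition has_in v (x : gen2) : bool :=
  [exists e : edge G, (ehead e == v) && (elabel e == x)].
Definition has_out v (x : gen2) : bool :=
  [exists e : edge G, (etail e == v) && (elabel e == x)].

(** Which label is numbered first within {C1, C3} and within {C2, C4} is a
    convention; [balanced3] does not depend on it. A loop at v counts both in
    [indeg v] and in [outdeg v]. *)
Definition C1 : nat := #|[set v | [&& indeg v == 1, outdeg v == 2 & has_in v gen_a]]|.
Definition C3 : nat := #|[set v | [&& indeg v == 1, outdeg v == 2 & has_in v gen_b]]|.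
Definition C2 : nat := #|[set v | [&& indeg v == 2, outdeg v == 1 & has_out v gen_a]]|.
Definition C4 : nat := #|[set v | [&& indeg v == 2, outdeg v == 1 & has_out v gen_b]]|.

Definition balanced3 : Prop := C1 + C3 = C2 + C4.

End Balanced.

(** * Directed trail decompositions *)

Section Trails.
Variables (X : Type) (G : lgraph X).

(** A nonempty sequence of edges is given by its first edge and the others. *)
Record trail := Trail {
  tfirst : edge G;
  trest : seq (edge G);
  trail_uniq : uniq (tfirst :: trest);
  trail_path : path (fun e f => etail f == ehead e) tfirst trest
}.

Definition tedges (P : trail) : {set edge G} := [set e in tfirst P :: trest P].

Definition tstart (P : trail) : vert G := etail (tfirst P).
Definition tterm (P : trail) : vert G := ehead (last (tfirst P) (trest P)).

Definition tverts (P : trail) : {set vert G} :=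
  [set v | [exists e in tedges P, (v == ehead e) || (v == etail e)]].

Definition met (n : nat) (P : 'I_n.+1 -> trail) (i : 'I_n.+1) : {set vert G} :=
  tverts (P i) :&: \bigcup_(j < n.+1 | j < i) tverts (P j).

Definition trail_decomposition (n : nat) (P : 'I_n.+1 -> trail) : Prop :=
  [/\ forall i j, i != j -> [disjoint tedges (P i) & tedges (P j)],
      \bigcup_i tedges (P i) = [set: edge G],
      tstart (P ord0) = tterm (P ord0)
    & forall i : 'I_n.+1, 0 < i ->
        (met P i != set0 -> met P i = [set tstart (P i); tterm (P i)]) /\
        (met P i = set0 -> tstart (P i) = tterm (P i))].

Definition has_trail_decomposition : Prop :=
  exists (n : nat) (P : 'I_n.+1 -> trail), trail_decomposition P.

End Trails.

(* Main.v *)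
(** A vertex that first appears on the trail [P_i] is either interior to [P_i]
    or lies on a closed trail, so it has both an incoming and an outgoing edge.
    In a folded graph on two labels in- and out-degrees are at most 2; hence
    in-degree and out-degree differ only at vertices of degree 3, where they
    differ by one, and summing both degrees over all vertices gives the
    balance. *)
Require Import Defs.
From mathcomp Require Import all_boot.

Set Implicit Arguments.
Unset Strict Implicit.
Unset Printing Implicit Defensive.

Section TrailVertices.
Variables (X : Type) (G : lgraph X).
Implicit Types (e f : edge G) (s : seq (edge G)) (v : vert G) (P : trail G).

Let consecutive e f := etail f == ehead e.

Lemma path_tail_preceded e f s : path consecutive e s -> f \in e :: s ->
  etail f = etail e \/ exists g, ehead g = etail f.
Proof.
elim: s e => [|g s IHs] e /=; first by rewrite inE => _ /eqP->; left.
case/andP=> /eqP eg gs; rewrite inE => /predU1P[->|fs]; first by left.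
(* If [f] leaves the same vertex as the second edge [g], then [e], which precedes [g], is the edge
   entering it. *)
by right; case: (IHs g gs fs) => [->|//]; exists e.
Qed.

Lemma path_head_followed e f s : path consecutive e s -> f \in e :: s ->
  ehead f = ehead (last e s) \/ exists g, etail g = ehead f.
Proof.
elim: s e => [|g s IHs] e /=; first by rewrite inE => _ /eqP->; left.
case/andP=> /eqP eg gs; rewrite inE => /predU1P[->|fs]; last exact: IHs.
by right; exists g.
Qed.

(** An edge of [P] at [v] gives one direction, and its neighbour along [P] gives the other. The
    neighbour is missing only at an end of [P]; there the trail must be closed, so its first edge
    leaves [v] and its last edge enters it. *)
Lemma trail_vertex_in_out P v : v \in tverts P ->
  tstart P = tterm P \/ v \notin [set tstart P; tterm P] ->
  (exists e, ehead e = v) /\ (exists e, etail e = v).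
Proof.
move=> vP cl.
have in_v : tstart P = v -> exists e, ehead e = v.
  case: cl => [-> <-|/[swap] <-]; last by rewrite !inE eqxx.
  by exists (last (tfirst P) (trest P)).
have out_v : tterm P = v -> exists e, etail e = v.
  case: cl => [<- <-|/[swap] <-]; last by rewrite !inE eqxx orbT.
  by exists (tfirst P).
move: vP; rewrite inE => /existsP[e /andP[+ /orP[]/eqP def_v]]; rewrite inE => eP.
  split; first by exists e.
  case: (path_head_followed (trail_path P) eP) => [ee|]; last by rewrite def_v.
  by apply: out_v; rewrite def_v ee.
split; last by exists e.
case: (path_tail_preceded (trail_path P) eP) => [ee|]; last by rewrite def_v.
by apply: in_v; rewrite def_v ee.
Qed.

Lemma trail_decomposition_in_out n (P : 'I_n.+1 -> trail G) (i : 'I_n.+1) v :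
  trail_decomposition P -> v \in tverts (P i) ->
  (exists e, ehead e = v) /\ (exists e, etail e = v).
Proof.
move=> [_ _ closed0 attached] viP.
(* Let [j] be the index of the first trail through [v]. *)
case: (arg_minnP (fun j : 'I_n.+1 => val j) (P := fun j => v \in tverts (P j)) viP)
  => j vPj minj.
apply: (trail_vertex_in_out vPj).
case: (posnP j) => [j0|/attached[met_ends met0]].
  by left; have -> : j = ord0 by apply: val_inj.
have [/eqP/met0|/met_ends <-] := boolP (met P j == set0); first by left.
(* The ends of [P j] all lie on earlier trails, while [v] does not, by minimality of [j]. *)
right; rewrite inE vPj /=; apply/bigcupP => -[k ltkj vPk].
by have := minj k vPk; rewrite leqNgt ltkj.
Qed.

(** The trails cover all edges, so every vertex with an edge lies on some trail. The form is an
    equivalence because an arbitrary graph may have isolated vertices. *)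
Lemma decomposed_in_out v : has_trail_decomposition G ->
  (exists e, ehead e = v) <-> (exists e, etail e = v).
Proof.
move=> [n [P decP]]; have [_ coverP _ _] := decP.
have ends e : (v == ehead e) || (v == etail e) ->
    (exists e, ehead e = v) /\ (exists e, etail e = v).
  move=> ve; have : e \in \bigcup_i tedges (P i) by rewrite coverP.
  case/bigcupP=> i _ eP; apply: (trail_decomposition_in_out (i := i) decP).
  by rewrite inE; apply/existsP; exists e; rewrite eP.
by split=> -[e /esym ve]; case: (ends e); rewrite ?ve ?eqxx ?orbT.
Qed.

End TrailVertices.

Section Degrees.
Variable G : lgraph gen2.
Implicit Type v : vert G.

Lemma sum_indeg : \sum_(v : vert G) indeg v = #|edge G|.
Proof.
rewrite -sum1_card (partition_big (@ehead _ G) predT) //=.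
by apply: eq_bigr => v _; rewrite sum1dep_card.
Qed.

Lemma sum_outdeg : \sum_(v : vert G) outdeg v = #|edge G|.
Proof.
rewrite -sum1_card (partition_big (@etail _ G) predT) //=.
by apply: eq_bigr => v _; rewrite sum1dep_card.
Qed.

Lemma indeg_gt0P v : reflect (exists e, ehead e = v) (0 < indeg v).
Proof.
by apply: (iffP card_gt0P) => -[e] => [|<-];
  [rewrite inE => /eqP|]; exists e; rewrite ?inE.
Qed.

Lemma outdeg_gt0P v : reflect (exists e, etail e = v) (0 < outdeg v).
Proof.
by apply: (iffP card_gt0P) => -[e] => [|<-];
  [rewrite inE => /eqP|]; exists e; rewrite ?inE.
Qed.

Lemma card_gen2 : #|{: gen2}| = 2.
Proof.
rewrite -card_bool; apply: (bij_eq_card (f := bool_of_gen2)).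
by exists gen2_of_bool; case.
Qed.

Lemma card_label_inj (A : {set edge G}) :
  {in A &, injective (@elabel _ G)} -> #|A| <= 2.
Proof. by move=> /card_in_imset <-; rewrite -card_gen2 max_card. Qed.

(** Two edges entering [v] with equal labels would be foldable, so labels are injective on them, and
    there are only two labels. *)
Lemma folded_indeg v : folded G -> indeg v <= 2.
Proof.
move=> foldedG; apply: card_label_inj => e f; rewrite !inE => /eqP ev /eqP fv ef.
have [//|/eqP nef] := eqVneq e f.
by case: (foldedG e f); split; rewrite // ev fv; left.
Qed.

Lemma folded_outdeg v : folded G -> outdeg v <= 2.
Proof.
move=> foldedG; apply: card_label_inj => e f; rewrite !inE => /eqP ev /eqP fv ef.
have [//|/eqP nef] := eqVneq e f.
by case: (foldedG e f); split; rewrite // ev fv; right.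
Qed.

(** This makes the two types with given degrees complementary: the single edge of [A] carries
    exactly one of the labels. *)
Lemma unique_edge_label (A : pred (edge G)) : #|[set e | A e]| = 1 ->
  [exists e, A e && (elabel e == gen_b)] =
    ~~ [exists e, A e && (elabel e == gen_a)].
Proof.
move/eqP/cards1P=> [e0 A_e0]; have {}A_e0 e : A e = (e == e0).
  by move/setP/(_ e): A_e0; rewrite !inE.
have ex_label x : [exists e, A e && (elabel e == x)] = (elabel e0 == x).
  apply/existsP/idP => [[e]|xe0]; first by rewrite A_e0 => /andP[/eqP->].
  by exists e0; rewrite A_e0 eqxx.
by rewrite !ex_label; case: (elabel e0).
Qed.

(** The label of the unique incoming edge splits these vertices into the two types, so adding the
    counts removes the label condition. *)
Lemma C1_C3 :
  C1 G + C3 G = \sum_(v : vert G) ((indeg v == 1) && (outdeg v == 2)).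
Proof.
rewrite /C1 /C3 -!sum1dep_card big_mkcond [X in _ + X]big_mkcond -big_split /=.
apply: eq_bigr => v _.
case: (eqVneq (indeg v) 1) => //= /unique_edge_label in_b.
by rewrite {2}/has_in in_b -/(has_in v gen_a); case: (outdeg v == 2); case: has_in.
Qed.

Lemma C2_C4 :
  C2 G + C4 G = \sum_(v : vert G) ((indeg v == 2) && (outdeg v == 1)).
Proof.
rewrite /C2 /C4 -!sum1dep_card big_mkcond [X in _ + X]big_mkcond -big_split /=.
apply: eq_bigr => v _.
case: (indeg v == 2) => //=.
case: (eqVneq (outdeg v) 1) => //= /unique_edge_label out_b.
by rewrite {2}/has_out out_b -/(has_out v gen_a); case: has_out.
Qed.

Lemma folded_decomposed_balanced :
  folded G -> has_trail_decomposition G -> balanced3 G.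
Proof.
move=> foldedG decG; rewrite /balanced3 C1_C3 C2_C4.
(* Adding the number of edges to both sides, as the sum of in-degrees on the left and of out-degrees
   on the right, turns the claim into an identity at each vertex. *)
apply: (@addnI (\sum_(v : vert G) indeg v)); rewrite {2}sum_indeg -sum_outdeg
  -!big_split /=.
apply: eq_bigr => v _.
have in_out : (0 < indeg v) = (0 < outdeg v).
  by apply/indeg_gt0P/outdeg_gt0P => /(decomposed_in_out v decG).
have := folded_indeg v foldedG; have := folded_outdeg v foldedG.
(* The possible pairs of degrees are (0,0), (1,1), (2,2), (1,2) and (2,1); in the last two the
   indicator makes up the difference. *)
by case: (indeg v) in_out => [|[|[|]]]; case: (outdeg v) => [|[|[|]]].
Qed.

End Degrees.

Theorem lemma3p7 (H : freegroup gen2 -> Prop) (Hsub : subgroup H)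
    (Hfg : finitely_generated H)
    (Gamma : lgraph gen2) (HGamma : is_folding H Gamma) :
  has_trail_decomposition Gamma -> balanced3 Gamma.
Proof.
by case: HGamma => S [_ _ _]; apply: folded_decomposed_balanced.
Qed.
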